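(* Let $\alpha,\beta,\gamma\in\mathbb{R}$ with $\gamma\neq 0$, and let $(G_2,g,J)$ be the connected, simply connected three-dimensional Lorentzian Lie group with product structure $J$ whose Lie algebra $\mathfrak{g}$ has a pseudo-orthonormal basis $\{e_1,e_2,e_3\}$ ($e_3$ timelike) with $[e_1,e_2]=\gamma e_2-\beta e_3$, $[e_1,e_3]=-\beta e_2-\gamma e_3$, $[e_2,e_3]=\alpha e_1$. Let $c\in\mathbb{R}$. Then $(G_2,g,J)$ is a first kind algebraic Ricci soliton associated to the canonical connection $\nabla^0$ with constant $c$ if and only if $\alpha=\beta=0$, $\gamma^2+c=0$, $\gamma\neq 0$. In particular, in that case $\mathrm{Ric}^0(e_1)=-\gamma^2e_1$, $\mathrm{Ric}^0(e_2)=-\gamma^2e_2$, $\mathrm{Ric}^0(e_3)=0$, and $De_1=0$, $De_2=0$, $De_3=\gamma^2e_3$.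
   Context: The left-invariant Lorentzian metric $g$ satisfies $g(e_1,e_1)=g(e_2,e_2)=1$, $g(e_3,e_3)=-1$, $g(e_i,e_j)=0$ for $i\ne j$. All tensors and connections are left-invariant and evaluated on $\mathfrak{g}$. $\nabla$ is the Levi-Civita connection of $g$. The product structure is $Je_1=e_1$, $Je_2=e_2$, $Je_3=-e_3$, and $(\nabla_XJ)Y=\nabla_X(JY)-J(\nabla_XY)$. The canonical connection is $\nabla^0_XY=\nabla_XY-\frac12(\nabla_XJ)(JY)$, with curvature $R^0(X,Y)Z=\nabla^0_X\nabla^0_YZ-\nabla^0_Y\nabla^0_XZ-\nabla^0_{[X,Y]}Z$. Its Ricci tensor is $\rho^0(X,Y)=-g(R^0(X,e_1)Y,e_1)-g(R^0(X,e_2)Y,e_2)+g(R^0(X,e_3)Y,e_3)$ and the Ricci operator $\mathrm{Ric}^0$ is defined by $\rho^0(X,Y)=g(\mathrm{Ric}^0(X),Y)$. First kind algebraic Ricci soliton associated to $\nabla^0$ with constant $c$ means: $\mathrm{Ric}^0=c\,\mathrm{Id}+D$ where $D$ is a derivation of $\mathfrak{g}$, i.e. a linear map with $D[X,Y]=[DX,Y]+[X,DY]$ for all $X,Y\in\mathfrak{g}$. *)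

(* Defs.v *)
From HB Require Import structures.
From mathcomp Require Import all_boot all_order all_algebra.
From mathcomp Require Import ring lra reals.

Set Implicit Arguments.
Unset Strict Implicit.
Unset Printing Implicit Defensive.

Import Order.TTheory GRing.Theory Num.Theory.
Local Open Scope ring_scope.

(* A left-invariant structure on a connected, simply connected Lie group is   *)
(* the same thing as the corresponding structure on its Lie algebra, here a   *)
(* finite-dimensional real vector space V with a bracket br.                  *)
Section LeftInvariant.
Context {R : realType} {V : vectType R}.

Definition lie_bracket (br : V -> V -> V) :=
  [/\ bilinear_for *:%R *:%R br,
      forall X, br X X = 0 &
      forall X Y Z, br X (br Y Z) + br Y (br Z X) + br Z (br X Y) = 0].

Definition derivation (br : V -> V -> V) (D : 'End(V)) :=
  forall X Y, D (br X Y) = br (D X) Y + br X (D Y).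

Definition pseudo_orthonormal_basis (g : {symmetric V}) (e1 e2 e3 : V) :=
  [/\ basis_of fullv [:: e1; e2; e3],
      [/\ g e1 e1 = 1, g e2 e2 = 1 & g e3 e3 = -1] &
      [/\ g e1 e2 = 0, g e1 e3 = 0 & g e2 e3 = 0]].

(* On left-invariant fields g Y Z is constant, so its derivative along X,     *)
(* which appears in metric compatibility, is 0.                               *)
Definition levi_civita (g : {symmetric V}) (br nabla : V -> V -> V) :=
  [/\ bilinear_for *:%R *:%R nabla,
      forall X Y, nabla X Y - nabla Y X = br X Y &
      forall X Y Z, g (nabla X Y) Z + g Y (nabla X Z) = 0].

Definition nablaJ (nabla : V -> V -> V) (J : 'End(V)) (X Y : V) : V :=
  nabla X (J Y) - J (nabla X Y).

Definition canonical_connection (nabla : V -> V -> V) (J : 'End(V))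
    (X Y : V) : V :=
  nabla X Y - 2^-1 *: nablaJ nabla J X (J Y).

Definition curvature (br nabla : V -> V -> V) (X Y Z : V) : V :=
  nabla X (nabla Y Z) - nabla Y (nabla X Z) - nabla (br X Y) Z.

Definition ricci_tensor (g : {symmetric V}) (e1 e2 e3 : V)
    (br nabla : V -> V -> V) (X Y : V) : R :=
  - g (curvature br nabla X e1 Y) e1 - g (curvature br nabla X e2 Y) e2
  + g (curvature br nabla X e3 Y) e3.

Definition ricci_operator (g : {symmetric V}) (rho : V -> V -> R)
    (Ric : 'End(V)) :=
  forall X Y, rho X Y = g (Ric X) Y.

Definition soliton_derivation (br : V -> V -> V) (Ric : 'End(V)) (c : R)
    (D : 'End(V)) :=
  derivation br D /\ Ric = c *: \1%VF + D.

Definition first_kind_algebraic_ricci_soliton (br : V -> V -> V) (Ric : 'End(V))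
    (c : R) :=
  exists D : 'End(V), soliton_derivation br Ric c D.

Lemma pseudo_orthonormal_expand (g : {symmetric V}) e1 e2 e3 :
  pseudo_orthonormal_basis g e1 e2 e3 ->
  forall X, X = g X e1 *: e1 + g X e2 *: e2 - g X e3 *: e3.
Proof.
move=> [be [g11 g22 g33] [g12 g13 g23]] X.
have sym Y Z : g Y Z = g Z Y by rewrite hermC /= expr0 mul1r.
have [a [b [d ->]]] : exists a b d, X = a *: e1 + b *: e2 + d *: e3.
  have : X \in <<[:: e1; e2; e3]>>%VS by rewrite (span_basis be) memvf.
  rewrite !span_cons span_nil addv0 => /memv_addP[_ /vlineP[a ->]].
  move=> [_ /memv_addP[_ /vlineP[b ->]] [_ /vlineP[d ->] ->] ->].
  by exists a, b, d; rewrite addrA.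
rewrite !linearDl /= !linearZl_LR /= g11 g22 g33 g12 g13 g23.
rewrite (sym e2 e1) (sym e3 e1) (sym e3 e2) g12 g13 g23.
by rewrite !mulr0 !mulr1 !addr0 !add0r mulrN1 scaleNr opprK.
Qed.

Definition koszul (g : {symmetric V}) (br : V -> V -> V) (X Y Z : V) : R :=
  g (br X Y) Z - g (br Y Z) X + g (br Z X) Y.

Lemma levi_civita_koszul (g : {symmetric V}) br nabla :
  levi_civita g br nabla ->
  forall X Y Z, g (nabla X Y) Z = koszul g br X Y Z / 2.
Proof.
move=> [_ tf mc] X Y Z.
have sym A B : g A B = g B A by rewrite hermC /= expr0 mul1r.
have t A B C : g (nabla A B) C - g (nabla B A) C = g (br A B) C.
  by rewrite -tf linearBl.
have m A B C : g (nabla A B) C = - g (nabla A C) B.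
  by rewrite [g (nabla A C) B]sym; apply/eqP; rewrite -addr_eq0 mc.
rewrite /koszul -!t.
move: (m X Y Z) (m Y X Z) (m Z X Y); lra.
Qed.

Lemma levi_civita_unique (g : {symmetric V}) e1 e2 e3 br nabla nabla' :
  pseudo_orthonormal_basis g e1 e2 e3 ->
  levi_civita g br nabla -> levi_civita g br nabla' ->
  forall X Y, nabla X Y = nabla' X Y.
Proof.
move=> he /levi_civita_koszul h /levi_civita_koszul h' X Y.
rewrite (pseudo_orthonormal_expand he (nabla X Y)).
by rewrite (pseudo_orthonormal_expand he (nabla' X Y)) !h !h'.
Qed.

Lemma levi_civita_exists (g : {symmetric V}) e1 e2 e3 br :
  pseudo_orthonormal_basis g e1 e2 e3 -> lie_bracket br ->
  exists nabla, levi_civita g br nabla.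
Proof.
move=> he [[brl brr] bralt _].
have sym A B : g A B = g B A by rewrite hermC /= expr0 mul1r.
have brC A B : br B A = - br A B.
  have := bralt (A + B); have := brl B 1 A A; have := brl B 1 A B.
  have := brr A 1 A B; have := brr B 1 A B; have := brl (A + B) 1 A B.
  rewrite /= !scale1r => -> -> -> _ _; rewrite !bralt addr0 add0r => /eqP.
  by rewrite addrC addr_eq0 => /eqP.
have bl k A B C : br (k *: A + B) C = k *: br A C + br B C by exact: brl.
have br_ k A B C : br C (k *: A + B) = k *: br C A + br C B by exact: brr.
have gl k A B C : g (k *: A + B) C = k * g A C + g B C.
  by rewrite linearDl linearZl_LR.
have gr k A B C : g C (k *: A + B) = k * g C A + g C B.
  by rewrite !(sym C) gl.
pose K X Y Z := koszul g br X Y Z / 2.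
pose nabla X Y := K X Y e1 *: e1 + K X Y e2 *: e2 - K X Y e3 *: e3.
have Kz X Y k A B : K X Y (k *: A + B) = k * K X Y A + K X Y B.
  by rewrite /K /koszul !bl !br_ !gl !gr; ring.
have Ky X Z k A B : K X (k *: A + B) Z = k * K X A Z + K X B Z.
  by rewrite /K /koszul !bl !br_ !gl !gr; ring.
have Kx Y Z k A B : K (k *: A + B) Y Z = k * K A Y Z + K B Y Z.
  by rewrite /K /koszul !bl !br_ !gl !gr; ring.
have lin3 (f : V -> R) : (forall k A B, f (k *: A + B) = k * f A + f B) ->
    forall a b d A B C, f (a *: A + b *: B - d *: C)
      = a * f A + b * f B - d * f C.
  move=> fl a b d A B C; rewrite -scaleNr -addrA.
  have f0 : f 0 = 0 by have := fl (-1) 0 0; rewrite scaler0 addr0; lra.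
  by rewrite fl fl -[_ *: C]addr0 fl f0; ring.
have nablaE X Y Z : g (nabla X Y) Z = K X Y Z.
  rewrite [in RHS](pseudo_orthonormal_expand he Z) (lin3 _ (Kz X Y)).
  rewrite (lin3 (g^~ Z) (fun k A B => gl k A B Z)) !(sym _ Z); ring.
have ext A B : (forall Z, g A Z = g B Z) -> A = B.
  move=> e; rewrite (pseudo_orthonormal_expand he A).
  by rewrite (pseudo_orthonormal_expand he B) !e.
have gB A B C : g (A - B) C = g A C - g B C by rewrite linearBl.
have gN A B : g (- A) B = - g A B by rewrite linearNl.
exists nabla; clearbody nabla; split.
- split=> [Y|X] k A B; apply: ext => Z.
    by rewrite [RHS]gl [LHS]nablaE Kx -!nablaE.
  by rewrite [RHS]gl [LHS]nablaE Ky -!nablaE.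
- move=> X Y; apply: ext => Z; rewrite gB !nablaE /K /koszul.
  rewrite (brC X Y) (brC X Z) (brC Y Z) !gN; lra.
- move=> X Y Z; rewrite [g Y _]sym !nablaE /K /koszul.
  rewrite (brC X Y) (brC X Z) (brC Y Z) !gN; lra.
Qed.

Lemma ricci_operator_exists (g : {symmetric V}) e1 e2 e3 (rho : V -> V -> R) :
  pseudo_orthonormal_basis g e1 e2 e3 ->
  bilinear_for *%R *%R rho -> exists Ric, ricci_operator g rho Ric.
Proof.
move=> he [rl rr].
have sym A B : g A B = g B A by rewrite hermC /= expr0 mul1r.
pose F X := rho X e1 *: e1 + rho X e2 *: e2 - rho X e3 *: e3.
have Fl : linear F.
  move=> k A B; have r Y : rho (k *: A + B) Y = k * rho A Y + rho B Y := rl Y k A B.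
  rewrite /F !r !scalerDl -!scalerA scalerBr scalerDr opprD.
  by rewrite (addrACA (k *: (rho A e1 *: e1))) [LHS]addrACA.
pose Fm := GRing.isLinear.Build _ _ _ _ F Fl.
pose F' : {linear V -> V} := HB.pack F Fm.
exists (linfun F') => X Y; rewrite lfunE /=.
have f1 k A B : rho X (k *: A + B) = k * rho X A + rho X B := rr X k A B.
have f0 : rho X 0 = 0 by have := f1 (-1) 0 0; rewrite scaler0 addr0; lra.
rewrite [in LHS](pseudo_orthonormal_expand he Y) -scaleNr -addrA !f1.
rewrite -[_ *: e3]addr0 f1 f0 /F linearBl !linearDl !linearZl_LR /=.
by rewrite !(sym _ Y); ring.
Qed.

Lemma canonical_connection_bilinear nabla (J : 'End(V)) :
  bilinear_for *:%R *:%R nabla ->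
  bilinear_for *:%R *:%R (canonical_connection nabla J).
Proof.
move=> [nl nr].
have subD (k : R) (A B C D : V) :
    (k *: A + B) - (k *: C + D) = k *: (A - C) + (B - D).
  by rewrite scalerBr opprD addrACA.
have Nl k A B C : nabla (k *: A + B) C = k *: nabla A C + nabla B C by exact: nl.
have Nr k A B C : nabla C (k *: A + B) = k *: nabla C A + nabla C B by exact: nr.
have Jl k A B : J (k *: A + B) = k *: J A + J B by rewrite linearP.
by split=> Y k A B; rewrite /applyr /canonical_connection /nablaJ;
  rewrite !(Nl, Jl, Nr) subD scalerDr scalerA [2^-1 * k]mulrC -scalerA subD.
Qed.

Lemma ricci_tensor_bilinear (g : {symmetric V}) e1 e2 e3 br nabla :
  bilinear_for *:%R *:%R br -> bilinear_for *:%R *:%R nabla ->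
  bilinear_for *%R *%R (ricci_tensor g e1 e2 e3 br nabla).
Proof.
move=> [bl _] [nl nr].
have subD (k : R) (A B C D : V) :
    (k *: A + B) - (k *: C + D) = k *: (A - C) + (B - D).
  by rewrite scalerBr opprD addrACA.
have Bl k A B C : br (k *: A + B) C = k *: br A C + br B C by exact: bl.
have Nl k A B C : nabla (k *: A + B) C = k *: nabla A C + nabla B C by exact: nl.
have Nr k A B C : nabla C (k *: A + B) = k *: nabla C A + nabla C B by exact: nr.
have gl k A B C : g (k *: A + B) C = k * g A C + g B C.
  by rewrite linearDl linearZl_LR.
by split=> Y k A B; rewrite /applyr /ricci_tensor /curvature;
  rewrite !(Bl, Nl, Nr) !subD !gl /=; ring.
Qed.

End LeftInvariant.

(* Main.v *)
(** The canonical connection commutes with J, hence preserves the splitting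
    of V into the plane spanned by e1, e2 and the line spanned by e3; it is
    therefore determined by the single 1-form w(X) = g(nabla_X e1, e2), and
    its curvature is the rotation of the plane by -w([X,Y]).  With the given
    brackets w is (0, -gamma, alpha/2) in the basis, so Ric^0 is explicit.
    Evaluated on pairs of basis vectors, the derivation identity for
    Ric^0 - c Id becomes a polynomial system in alpha, beta, gamma and c. *)
Require Import Defs.
From mathcomp Require Import all_boot all_order all_algebra.
From mathcomp Require Import ring lra reals.
Import Order.TTheory GRing.Theory Num.Theory.
Local Open Scope ring_scope.

(** * Bilinear maps and derivations tested on a basis *)

Section BilinearOnBasis.
Context {R : realType} {V : vectType R}.
Implicit Types (f br : V -> V -> V) (D : 'End(V)).

Lemma bilinear_add f : bilinear_for *:%R *:%R f ->
  (forall X Y Z, f (X + Y) Z = f X Z + f Y Z) *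
  (forall X Y Z, f X (Y + Z) = f X Y + f X Z).
Proof.
move=> [fl fr]; split=> X Y Z.
  by have := fl Z 1 X Y; rewrite /= !scale1r.
by have := fr X 1 Y Z; rewrite /= !scale1r.
Qed.

(** Bilinearity is given on combinations [k *: X + Y]. Homogeneity is the case [Y = 0], once
    additivity and cancellation have shown that [f] vanishes at 0. *)
Lemma bilinear_scale f : bilinear_for *:%R *:%R f ->
  (forall k X Y, f (k *: X) Y = k *: f X Y) *
  (forall k X Y, f X (k *: Y) = k *: f X Y).
Proof.
move=> hf; have [fDl fDr] := bilinear_add f hf; case: (hf) => fl fr.
have f0l X : f 0 X = 0 by apply: (addrI (f 0 X)); rewrite -fDl !addr0.
have f0r X : f X 0 = 0 by apply: (addrI (f X 0)); rewrite -fDr !addr0.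
split=> k X Y.
  by have := fl Y k X 0; rewrite /= !addr0 f0l addr0.
by have := fr X k Y 0; rewrite /= !addr0 f0r addr0.
Qed.

Lemma alternating_antisym f : bilinear_for *:%R *:%R f ->
  (forall X, f X X = 0) -> forall X Y, f Y X = - f X Y.
Proof.
move=> /bilinear_add[fDl fDr] alt X Y; have := alt (X + Y).
rewrite fDl !fDr !alt add0r addr0 => /eqP.
by rewrite addrC addr_eq0 => /eqP.
Qed.

Lemma basis3_expand (e1 e2 e3 : V) : basis_of fullv [:: e1; e2; e3] ->
  forall X, exists a b d, X = a *: e1 + b *: e2 + d *: e3.
Proof.
move=> be X.
have : X \in <<[:: e1; e2; e3]>>%VS by rewrite (span_basis be) memvf.
rewrite !span_cons span_nil addv0 => /memv_addP[_ /vlineP[a ->]].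
move=> [_ /memv_addP[_ /vlineP[b ->]] [_ /vlineP[d ->] ->] ->].
by exists a, b, d; rewrite addrA.
Qed.

Lemma alternating_eq0 (e1 e2 e3 : V) f : basis_of fullv [:: e1; e2; e3] ->
  bilinear_for *:%R *:%R f -> (forall X, f X X = 0) ->
  f e1 e2 = 0 -> f e1 e3 = 0 -> f e2 e3 = 0 -> forall X Y, f X Y = 0.
Proof.
move=> be hf alt f12 f13 f23 X Y.
have fC := alternating_antisym f hf alt.
have [fDl fDr] := bilinear_add f hf; have [fZl fZr] := bilinear_scale f hf.
have [a [b [d ->]]] := basis3_expand _ _ _ be X.
have [a' [b' [d' ->]]] := basis3_expand _ _ _ be Y.
rewrite !(fDl, fDr, fZl, fZr) !alt (fC e1 e2) (fC e1 e3) (fC e2 e3).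
by rewrite f12 f13 f23 !(oppr0, scaler0, addr0).
Qed.

(** The failure of the Leibniz rule is itself an alternating bilinear map, so it vanishes as soon as
    it does on the three pairs of distinct basis vectors. *)
Lemma derivation_on_basis (e1 e2 e3 : V) br D :
  basis_of fullv [:: e1; e2; e3] -> lie_bracket br ->
  D (br e1 e2) = br (D e1) e2 + br e1 (D e2) ->
  D (br e1 e3) = br (D e1) e3 + br e1 (D e3) ->
  D (br e2 e3) = br (D e2) e3 + br e2 (D e3) ->
  derivation br D.
Proof.
move=> be [hb alt _] d12 d13 d23 X Y.
have brC := alternating_antisym br hb alt.
have [bDl bDr] := bilinear_add br hb; have [bZl bZr] := bilinear_scale br hb.
have DP k A B : D (k *: A + B) = k *: D A + D B by rewrite linearP.
pose defect X Y := D (br X Y) - (br (D X) Y + br X (D Y)).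
have subD (k : R) (A B A' B' C C' : V) : k *: A + B -
    ((k *: A' + B') + (k *: C + C')) = k *: (A - (A' + C)) + (B - (B' + C')).
  by rewrite addrACA -scalerDr opprD addrACA -scalerBr.
apply/eqP; rewrite -subr_eq0; apply/eqP.
apply: (alternating_eq0 e1 e2 e3 defect be); rewrite /defect.
- by split=> Z k A B;
    rewrite /applyr /= !(bDl, bDr, bZl, bZr, DP) subD.
- by move=> Z; rewrite alt (brC Z (D Z)) addNr linear0 subr0.
- by rewrite d12 subrr.
- by rewrite d13 subrr.
- by rewrite d23 subrr.
Qed.

End BilinearOnBasis.

(** * The canonical connection, its curvature and its Ricci tensor *)

Section Canonical.
Context {R : realType} {V : vectType R}.
Variables (g : {symmetric V}) (e1 e2 e3 : V).
Hypothesis hg : pseudo_orthonormal_basis g e1 e2 e3.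

Lemma metricC X Y : g X Y = g Y X.
Proof. by rewrite hermC /= expr0 mul1r. Qed.

Lemma metric_ext A B :
  g A e1 = g B e1 -> g A e2 = g B e2 -> g A e3 = g B e3 -> A = B.
Proof.
move=> h1 h2 h3; rewrite (pseudo_orthonormal_expand hg A).
by rewrite (pseudo_orthonormal_expand hg B) h1 h2 h3.
Qed.

Lemma metric_basis :
  ((g e1 e1 = 1) * (g e1 e2 = 0) * (g e1 e3 = 0)) *
  ((g e2 e1 = 0) * (g e2 e2 = 1) * (g e2 e3 = 0)) *
  ((g e3 e1 = 0) * (g e3 e2 = 0) * (g e3 e3 = -1)).
Proof.
case: hg => _ [g11 g22 g33] [g12 g13 g23].
by rewrite (metricC e2 e1) (metricC e3 e1) (metricC e3 e2).
Qed.

Lemma metric_linear :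
  ((forall A B C, g (A + B) C = g A C + g B C) *
   (forall A B C, g (A - B) C = g A C - g B C)) *
  ((forall A C, g (- A) C = - g A C) *
   (forall k A C, g (k *: A) C = k * g A C)) * (forall C, g 0 C = 0).
Proof.
split; last by move=> C; rewrite linear0l.
split; split=> *; by rewrite ?linearDl ?linearBl ?linearNl ?linearZl_LR.
Qed.

Definition metricE := (metric_linear, metric_basis).

Variables (br nabla : V -> V -> V) (J : 'End(V)).
Hypothesis hJ : [/\ J e1 = e1, J e2 = e2 & J e3 = - e3].
Hypothesis hbr : lie_bracket br.
Hypothesis hnabla : levi_civita g br nabla.

Let w X := g (nabla X e1) e2.
Let nabla0 := canonical_connection nabla J.

(** Since J squares to the identity, the canonical connection is the mean of [nabla X] and its
    conjugate by J, which removes the terms mixing e3 with the plane. Metric compatibility makes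
    [nabla X] skew, leaving a rotation on the plane and 0 on the line. *)
Lemma canonical_connection_e X :
  [/\ nabla0 X e1 = w X *: e2, nabla0 X e2 = - w X *: e1 & nabla0 X e3 = 0].
Proof.
case: hJ hnabla => J1 J2 J3 [bn _ mc].
have [nZl nZr] := bilinear_scale _ bn.
have nN Y : nabla X (- Y) = - nabla X Y by rewrite -scaleN1r nZr scaleN1r.
(* The e3 coordinate of Y is [- g Y e3], and J reverses it: hence the plus sign. *)
have JE Y : J Y = g Y e1 *: e1 + g Y e2 *: e2 + g Y e3 *: e3.
  rewrite [in LHS](pseudo_orthonormal_expand hg Y) linearB linearD !linearZ /=.
  by rewrite J1 J2 J3 opprK.
have m Y Z : g (nabla X Y) Z = - g (nabla X Z) Y.
  by apply/eqP; rewrite -addr_eq0 [g (nabla X Z) Y]metricC mc.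
have m0 Y : g (nabla X Y) Y = 0 by have := m Y Y; lra.
rewrite /nabla0 /canonical_connection /nablaJ J1 J2 J3 linearN /= !nN !linearN /=.
rewrite !J1 !J2 !J3 !nN !JE.
split; apply: metric_ext; rewrite !metricE ?m0 /w; have := m e1 e2; lra.
Qed.

(** The operators [nabla0 X] and [nabla0 Y] are multiples of one infinitesimal rotation, so they
    commute and only the bracket term of the curvature survives. *)
Lemma canonical_curvature_e X Y :
  [/\ curvature br nabla0 X Y e1 = - w (br X Y) *: e2,
      curvature br nabla0 X Y e2 = w (br X Y) *: e1 &
      curvature br nabla0 X Y e3 = 0].
Proof.
case: hnabla => bn _ _.
have [_ nZ] := bilinear_scale nabla0 (canonical_connection_bilinear J bn).
have e Z := canonical_connection_e Z.
have [[x1 x2 x3] [y1 y2 y3]] := (e X, e Y); have [z1 z2 z3] := e (br X Y).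
rewrite /curvature x1 x2 x3 y1 y2 y3 z1 z2 z3 !nZ x1 x2 y1 y2.
have n0 Z : nabla0 Z 0 = 0 by rewrite -(scale0r e1) nZ !scale0r.
rewrite !n0 !scalerA; split; last by rewrite !subrr.
- by apply: metric_ext; rewrite !metricE; ring.
- by apply: metric_ext; rewrite !metricE; ring.
Qed.

(** The curvature sends e1 to a multiple of e2, e2 to a multiple of e1, and e3 to 0, so at most one
    of the three terms of the trace is nonzero. *)
Lemma canonical_ricci_e X :
  let rho := ricci_tensor g e1 e2 e3 br nabla0 in
  [/\ rho X e1 = w (br X e2), rho X e2 = - w (br X e1) & rho X e3 = 0].
Proof.
rewrite /ricci_tensor.
have [a1 a2 a3] := canonical_curvature_e X e1.
have [b1 b2 b3] := canonical_curvature_e X e2.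
have [d1 d2 d3] := canonical_curvature_e X e3.
by rewrite a1 a2 a3 b1 b2 b3 d1 d2 d3; split; rewrite !metricE; ring.
Qed.

(** * The Ricci operator and the soliton condition for the given brackets *)

Variables (alpha beta gamma : R) (Ric : 'End(V)).
Hypothesis h12 : br e1 e2 = gamma *: e2 - beta *: e3.
Hypothesis h13 : br e1 e3 = - beta *: e2 - gamma *: e3.
Hypothesis h23 : br e2 e3 = alpha *: e1.
Hypothesis hRic : ricci_operator g (ricci_tensor g e1 e2 e3 br nabla0) Ric.

Lemma canonical_form_e : [/\ w e1 = 0, w e2 = - gamma & w e3 = alpha / 2].
Proof.
case: hbr => bb alt _; have brC := alternating_antisym _ bb alt.
rewrite /w !(levi_civita_koszul hnabla) /koszul.
rewrite (brC e1 e2) (brC e1 e3) !alt h12 h13 h23 !metricE.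
by split; field.
Qed.

(** Pairing with e1, e2, e3 recovers [Ric] from the Ricci tensor. As [rho X e3 = 0], the image lies
    in the plane; the tensor need not be symmetric, and [Ric e3] can have an e2 component, equal to
    [w (br e1 e3)]. *)
Lemma canonical_ricci_operator :
  [/\ Ric e1 = - (gamma ^+ 2 + alpha * beta / 2) *: e1,
      Ric e2 = - (gamma ^+ 2 + alpha * beta / 2) *: e2 &
      Ric e3 = (gamma * (beta - alpha / 2)) *: e2].
Proof.
case: hbr => bb alt _; have brC := alternating_antisym _ bb alt.
case: hnabla => bn _ _.
have [nD _] := bilinear_add _ bn; have [nZ _] := bilinear_scale _ bn.
have wD A B : w (A + B) = w A + w B by rewrite /w nD metricE.
have wZ k A : w (k *: A) = k * w A by rewrite /w nZ metricE.
have w0 : w 0 = 0 by rewrite -(scale0r e1) wZ mul0r.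
have [w1 w2 w3] := canonical_form_e.
have gRic X := canonical_ricci_e X.
split; apply: metric_ext; rewrite -hRic;
  [have [r _ _] := gRic e1|have [_ r _] := gRic e1|have [_ _ r] := gRic e1
  |have [r _ _] := gRic e2|have [_ r _] := gRic e2|have [_ _ r] := gRic e2
  |have [r _ _] := gRic e3|have [_ r _] := gRic e3|have [_ _ r] := gRic e3];
  rewrite r ?alt ?(brC e1 e2) ?(brC e1 e3) ?(brC e2 e3) ?h12 ?h13 ?h23;
  rewrite -?scaleNr -?scaleN1r ?(wD, wZ, w0) ?w1 ?w2 ?w3 !metricE; by field.
Qed.

(** Here [k] is the eigenvalue of D on the plane, and [m] is the e2 component of [D e3], whose e3
    component is [- c]. *)
Lemma soliton_equations c : first_kind_algebraic_ricci_soliton br Ric c ->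
  let k := - (gamma ^+ 2 + alpha * beta / 2) - c in
  let m := gamma * (beta - alpha / 2) in
  [/\ gamma * k = - (beta * m), beta * c = - (2 * gamma * m) & c * alpha = 0].
Proof.
move=> [D [dD eD]] k m; have [r1 r2 r3] := canonical_ricci_operator.
have DE X : D X = Ric X - c *: X.
  by rewrite eD add_lfunE scale_lfunE id_lfunE addrC addKr.
case: hbr => bb _ _.
have [bDl bDr] := bilinear_add _ bb; have [bZl bZr] := bilinear_scale _ bb.
have D1 : D e1 = k *: e1 by rewrite DE r1 /k scalerBl.
have D2 : D e2 = k *: e2 by rewrite DE r2 /k scalerBl.
have D3 : D e3 = m *: e2 + (- c) *: e3 by rewrite DE r3 /m scaleNr.
have br22 : br e2 e2 = 0 by case: hbr.
have E12 := dD e1 e2; have E13 := dD e1 e3; have E23 := dD e2 e3.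
rewrite h12 linearB !linearZ /= D1 D2 D3 !(bZl, bZr) h12 in E12.
rewrite h13 linearB !linearZ /= D1 D2 D3 !(bDr, bZl, bZr) h12 h13 in E13.
rewrite h23 linearZ /= D1 D2 D3 !(bDr, bZl, bZr) h23 br22 in E23.
(* The three equations are, in order, the e2 coordinates for the pairs (e1, e2) and (e1, e3) and the
   e1 coordinate for (e2, e3). *)
have := congr1 (g^~ e2) E12; have := congr1 (g^~ e2) E13.
have := congr1 (g^~ e1) E23; rewrite /= !metricE => q1 q2 q3.
split; lra.
Qed.

(** In this case D is diagonal with entries 0, 0, [gamma ^+ 2]. The operator [br e1] is diagonal
    too, D kills e1, and e2 commutes with e3, so D is a derivation. *)
Lemma soliton_of_parameters c : alpha = 0 -> beta = 0 -> gamma ^+ 2 + c = 0 ->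
  first_kind_algebraic_ricci_soliton br Ric c.
Proof.
move=> a0 b0 gc; have [r1 r2 r3] := canonical_ricci_operator.
have c0 : c = - gamma ^+ 2 by lra.
exists (Ric - c *: \1%VF); split; last by rewrite addrC subrK.
set D := Ric - _.
have DE X : D X = Ric X - c *: X.
  by rewrite add_lfunE opp_lfunE scale_lfunE id_lfunE.
case: hbr => bb _ _; have [bZl bZr] := bilinear_scale _ bb.
have b0l X : br 0 X = 0 by rewrite -(scale0r e1) bZl !scale0r.
have b0r X : br X 0 = 0 by rewrite -(scale0r e1) bZr !scale0r.
have D1 : D e1 = 0.
  by rewrite DE r1 -scalerBl a0 c0 (_ : _ - _ = 0) ?scale0r //; field.
have D2 : D e2 = 0.
  by rewrite DE r2 -scalerBl a0 c0 (_ : _ - _ = 0) ?scale0r //; field.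
have D3 : D e3 = gamma ^+ 2 *: e3.
  by rewrite DE r3 a0 b0 c0 mul0r subr0 mulr0 scale0r sub0r scaleNr opprK.
case: hg => be _ _; apply: (derivation_on_basis e1 e2 e3) => //.
- rewrite h12 D1 D2 linearB !linearZ /= D2 D3 b0 b0l b0r.
  by rewrite !(scale0r, scaler0, oppr0, addr0).
- rewrite h13 D1 D3 linearB !linearZ /= D2 D3 b0 b0l bZr h13 b0.
  by rewrite !(oppr0, scale0r, scaler0, sub0r, add0r, scalerN, scalerA) mulrC.
- rewrite h23 D2 D3 linearZ /= D1 b0l bZr h23 a0.
  by rewrite !(scale0r, scaler0, addr0).
Qed.

End Canonical.

(** * Solving the polynomial system *)

Lemma soliton_parameters (R : realType) (a b y c : R) : y != 0 ->
  let k := - (y ^+ 2 + a * b / 2) - c in let m := y * (b - a / 2) in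
  y * k = - (b * m) -> b * c = - (2 * y * m) -> c * a = 0 ->
  [/\ a = 0, b = 0 & y ^+ 2 + c = 0].
Proof.
move=> y0 k m E1 E2 E3.
have y2 : 0 < y ^+ 2 by rewrite exprn_even_gt0.
(* The first equation divided by [y]. *)
have F1 : y ^+ 2 + c + a * b = b ^+ 2.
  by apply: (mulfI y0); move: E1; rewrite /k /m; nra.
(* If [a] is nonzero, then [c = 0] and [b = a / 2], so [F1] gives [y ^+ 2 = - a ^+ 2 / 4], which is
   not positive. *)
have a0 : a = 0.
  apply: contraTeq y2 => a_n0; move: E3 => /eqP.
  rewrite mulf_eq0 (negPf a_n0) orbF => /eqP c0.
  have : y * (y * (b - a / 2)) = 0 by move: E2; rewrite c0 /m; lra.
  move=> /eqP; rewrite !mulf_eq0 (negPf y0) /= => /eqP hb.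
  by rewrite -leNgt; have := sqr_ge0 a; nra.
(* If [b] is nonzero, the second equation gives [c], and [F1] becomes [y ^+ 2 = - b ^+ 2]. *)
have b0 : b = 0.
  apply: contraTeq y2 => b_n0.
  have hc : c = - (2 * y ^+ 2).
    by apply: (mulfI b_n0); move: E2; rewrite /m a0; lra.
  by rewrite -leNgt; have := sqr_ge0 b; move: F1; rewrite hc a0; lra.
by split=> //; move: F1; rewrite a0 b0; lra.
Qed.

Theorem theorem2p16 (R : realType) (alpha beta gamma : R) (V : vectType R)
    (br : V -> V -> V) (g : {symmetric V}) (J : 'End(V)) (e1 e2 e3 : V)
    (nabla : V -> V -> V) (Ric0 : 'End(V)) (c : R)
    (hgamma : gamma != 0)
    (hbr : lie_bracket br)
    (hg : pseudo_orthonormal_basis g e1 e2 e3)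
    (h12 : br e1 e2 = gamma *: e2 - beta *: e3)
    (h13 : br e1 e3 = - beta *: e2 - gamma *: e3)
    (h23 : br e2 e3 = alpha *: e1)
    (hJ : [/\ J e1 = e1, J e2 = e2 & J e3 = - e3])
    (hnabla : levi_civita g br nabla)
    (hRic0 : ricci_operator g
       (ricci_tensor g e1 e2 e3 br (canonical_connection nabla J)) Ric0) :
  (first_kind_algebraic_ricci_soliton br Ric0 c <->
     [/\ alpha = 0, beta = 0, gamma ^+ 2 + c = 0 & gamma != 0]) /\
  (first_kind_algebraic_ricci_soliton br Ric0 c ->
     [/\ Ric0 e1 = - gamma ^+ 2 *: e1,
         Ric0 e2 = - gamma ^+ 2 *: e2,
         Ric0 e3 = 0 &
         forall D : 'End(V), soliton_derivation br Ric0 c D ->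
           [/\ D e1 = 0, D e2 = 0 & D e3 = gamma ^+ 2 *: e3]]).
Proof.
have par : first_kind_algebraic_ricci_soliton br Ric0 c ->
    [/\ alpha = 0, beta = 0 & gamma ^+ 2 + c = 0].
  move=> s.
  have [E1 E2 E3] := soliton_equations g e1 e2 e3 hg br nabla J hJ hbr hnabla
    alpha beta gamma Ric0 h12 h13 h23 hRic0 c s.
  exact: soliton_parameters E1 E2 E3.
split; first split=> [/par[]//|[a0 b0 gc _]].
  exact: (soliton_of_parameters g e1 e2 e3 hg br nabla J hJ hbr hnabla
    alpha beta gamma Ric0 h12 h13 h23 hRic0 c).
move=> /par[a0 b0 gc].
have [r1 r2 r3] := canonical_ricci_operator g e1 e2 e3 hg br nabla J hJ hbr
  hnabla alpha beta gamma Ric0 h12 h13 h23 hRic0.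
rewrite a0 b0 !mul0r addr0 in r1 r2.
rewrite a0 b0 mul0r subr0 mulr0 scale0r in r3.
(* The soliton equation alone determines D, as [Ric0 - c Id]. *)
split=> // D [_ eD].
have DE X : D X = Ric0 X - c *: X.
  by rewrite eD add_lfunE scale_lfunE id_lfunE addrC addKr.
have -> : gamma ^+ 2 = - c by lra.
have gE : - gamma ^+ 2 = c by lra.
by rewrite !DE r1 r2 r3 gE !subrr sub0r scaleNr.
Qed.
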